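(* Let $y_1,\ldots,y_n\in\mathbb{R}$ be arbitrary and let $k\ge0$ be an integer. Then there is a $k$th degree discrete spline interpolant $f\in\mathcal{H}^k_n=\mathrm{span}\{h^k_1,\ldots,h^k_n\}$ (with knots in $\{x_{k+1},\ldots,x_{n-1}\}$) satisfying $f(x_i)=y_i$, $i=1,\ldots,n$, given by $$f(x)=\sum_{i=1}^{k+1}(\Delta^{k+1}_nf)(x_i)\cdot h^k_i(x)+\sum_{i=k+2}^n(\Delta^{k+1}_nf)(x_i)\cdot\frac{x_i-x_{i-k-1}}{k+1}\cdot h^k_i(x),\qquad x\in[a,b],$$ where the discrete derivatives $(\Delta^{k+1}_nf)(x_i)$, $i=1,\ldots,n$, depend only on the values $y_1,\ldots,y_n$. Moreover, this representation is unique: the interpolant in $\mathcal{H}^k_n$, and its coefficients in the basis $h^k_1,\ldots,h^k_n$, are unique.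
   Context: Design points: $a\le x_1<\cdots<x_n\le b$ with $n\ge k+1$, and $x_{n+1}=b$. Empty products equal 1. Divided differences: $f[z]=f(z)$ and $f[z_1,\ldots,z_{r+1}]=(f[z_2,\ldots,z_{r+1}]-f[z_1,\ldots,z_r])/(z_{r+1}-z_1)$ for distinct points. Discrete derivatives, for $d\ge1$: $(\Delta^d_nf)(x)=d!\,f[x_{i-d+1},\ldots,x_i,x]$ if $x\in(x_i,x_{i+1}]$, $i\ge d$; $(\Delta^d_nf)(x)=i!\,f[x_1,\ldots,x_i,x]$ if $x\in(x_i,x_{i+1}]$, $1\le i<d$; $(\Delta^d_nf)(x)=f(x)$ if $x\le x_1$. Falling factorial basis: $h^k_j(x)=\frac1{(j-1)!}\prod_{\ell=1}^{j-1}(x-x_\ell)$ for $j=1,\ldots,k+1$, and $h^k_j(x)=\frac1{k!}\prod_{\ell=j-k}^{j-1}(x-x_\ell)\cdot1\{x>x_{j-1}\}$ for $j=k+2,\ldots,n$. The space $\mathcal{H}^k_n$ is called the space of $k$th degree discrete splines with knots in $\{x_{k+1},\ldots,x_{n-1}\}$. *)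

(* Defs.v *)
From mathcomp Require Import all_boot all_order all_algebra.
From mathcomp Require Import reals.

Set Implicit Arguments.
Unset Strict Implicit.
Unset Printing Implicit Defensive.
Import Order.TTheory GRing.Theory Num.Theory.
Local Open Scope ring_scope.

(* Design points are a map x : nat -> R indexed from 1: x 1, ..., x n are the
   points and x n.+1 is the right end point b of the domain; no other value
   of x is used. Functions on [a, b] are maps R -> R considered on `[a, b]. *)

(* f[z 0, ..., z r] *)
Fixpoint divdiff_rec (R : realType) (f : R -> R) (r : nat) (z : nat -> R) : R :=
  if r is r'.+1 then
    (divdiff_rec f r' (fun l => z l.+1) - divdiff_rec f r' z) / (z r - z 0%N)
  else f (z 0%N).

Definition divdiff (R : realType) (f : R -> R) (s : seq R) : R :=
  divdiff_rec f (size s).-1 (nth 0 s).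

(* The last branch is only reached for t > x n.+1 = b, outside the domain. *)
Definition discrete_deriv (R : realType) (n : nat) (x : nat -> R) (d : nat)
    (f : R -> R) (t : R) : R :=
  if t <= x 1%N then f t
  else if [pick i : 'I_n.+1 | (0 < i)%N && (x i < t <= x i.+1)] is Some i then
    if (d <= i)%N then
      d`!%:R * divdiff f (rcons [seq x l | l <- index_iota (i - d).+1 i.+1] t)
    else
      i`!%:R * divdiff f (rcons [seq x l | l <- index_iota 1 i.+1] t)
  else 0.

Definition ffact_basis (R : realType) (k : nat) (x : nat -> R) (j : nat)
    (t : R) : R :=
  if (j <= k.+1)%N then
    (j.-1)`!%:R^-1 * \prod_(1 <= l < j) (t - x l)
  else
    k`!%:R^-1 * \prod_(j - k <= l < j) (t - x l) * (x j.-1 < t)%R%:R.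

Definition discrete_spline (R : realType) (a b : R) (n k : nat) (x : nat -> R)
    (f : R -> R) : Prop :=
  exists c : nat -> R, {in `[a, b], forall t : R,
    f t = \sum_(1 <= j < n.+1) c j * ffact_basis k x j t}.

(* Main.v *)
Require Import Defs.
From mathcomp Require Import all_boot all_order all_algebra.
From mathcomp Require Import reals.
From mathcomp Require Import zify ring.

Set Implicit Arguments.
Unset Strict Implicit.
Unset Printing Implicit Defensive.
Import Order.TTheory GRing.Theory Num.Theory.
Local Open Scope ring_scope.

(** The values of the basis functions at the design points form a triangular
    matrix: [h_j] vanishes at [x_1, ..., x_(j-1)] (lemma
    [ffact_basis_design_eq0]) and not at [x_j].  Triangular solving
    ([triangular_solve]) therefore produces coefficients [c_1, ..., c_n] for
    which [\sum_j c_j h_j] interpolates any prescribed values.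

    The coefficients are then read off by a biorthogonality argument.  At
    [x_i] the discrete derivative is, up to a factorial, a divided difference
    over design points ([discrete_deriv_low] and [discrete_deriv_high]); it is
    linear in the function and uses only its values at these points.  The
    weighted divided difference attached to [i] sends [h_j] to [1] if [j = i]
    and to [0] otherwise ([divdiff_basis_low], [divdiff_basis_high]).  The one
    computation behind this is [divdiff_prod]: on [r + 1] distinct nodes, a
    product of [r] monic linear factors has divided difference [1], and a
    product of fewer factors has divided difference [0].
    - For [i <= k + 1] the functional is [f |-> (i-1)! f[x_1, ..., x_i]], and
      the [h_j] that do not vanish on its nodes are the Newton polynomials.
    - For [i = m + k + 1] with [m >= 1], the factor
      [(x_i - x_m) / (k + 1)] clears the last denominator, so the functional is
      [f |-> k! (f[x_(m+1), ..., x_i] - f[x_m, ..., x_(i-1)])].  For [j < i]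
      the function [h_j] agrees on all these nodes with one polynomial of
      degree at most [k], so the two divided differences cancel; [h_i] vanishes
      on the second set of nodes, and on the first it is [1 / k!] times a monic
      polynomial of degree [k]; for [j > i] the function vanishes on all nodes.

    Hence every discrete spline has, as its coefficients in the basis, the
    weighted discrete derivatives in the statement ([coef_low], [coef_high]).
    As these depend only on the values at the design points, this gives the
    explicit formula and the uniqueness of the interpolant and of its
    coefficients together. *)

(** * Divided differences *)

Lemma eq_divdiff_rec (R : realType) (f g : R -> R) r (z z' : nat -> R) :
  (forall l, (l <= r)%N -> z l = z' l) ->
  (forall l, (l <= r)%N -> f (z l) = g (z l)) ->
  divdiff_rec f r z = divdiff_rec g r z'.
Proof.
elim: r z z' => [|r IHr] z z' eqz eqf /=; first by rewrite eqf // eqz.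
have -> : divdiff_rec f r (fun l => z l.+1) = divdiff_rec g r (fun l => z' l.+1).
  by apply: IHr => l le_lr; [apply: eqz | apply: eqf].
have -> : divdiff_rec f r z = divdiff_rec g r z'.
  by apply: IHr => l le_lr; [apply: eqz | apply: eqf]; apply: leqW.
by rewrite !eqz.
Qed.

Lemma divdiff_rec0 (R : realType) r (z : nat -> R) :
  divdiff_rec (fun=> 0) r z = 0.
Proof. by elim: r z => [|r IHr] z //=; rewrite !IHr subr0 mul0r. Qed.

Lemma divdiff_recZ (R : realType) (a : R) (f : R -> R) r (z : nat -> R) :
  divdiff_rec (fun t => a * f t) r z = a * divdiff_rec f r z.
Proof. by elim: r z => [|r IHr] z //=; rewrite !IHr -mulrBr mulrA. Qed.

Lemma divdiff_rec_sum (R : realType) (s : seq nat) (c : nat -> R)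
    (h : nat -> R -> R) r (z : nat -> R) :
  divdiff_rec (fun t => \sum_(j <- s) c j * h j t) r z
  = \sum_(j <- s) c j * divdiff_rec (h j) r z.
Proof.
elim: r z => [|r IHr] z //=; rewrite !IHr -sumrB mulr_suml.
by apply: eq_bigr => j _; rewrite -mulrBr mulrA.
Qed.

(** The Leibniz rule for a linear factor.  The product rule can put the linear
    factor at the first node or at the last one; the inductive step uses the
    latter form on the upper nodes and the former on the lower nodes, where
    both leave the same divided difference over the inner nodes. *)
Lemma divdiff_rec_mulXsub (R : realType) (w : R) (g : R -> R) r
    (z : nat -> R) :
  (forall l m, (l < m <= r.+1)%N -> z l != z m) ->
  divdiff_rec (fun t => (t - w) * g t) r.+1 z
  = (z 0%N - w) * divdiff_rec g r.+1 z
    + divdiff_rec g r (fun l => z l.+1).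
Proof.
elim: r z => [|r IHr] z z_inj.
  have d : z 1%N - z 0%N != 0 by rewrite subr_eq0 eq_sym z_inj.
  by rewrite /=; field.
have IHl : divdiff_rec (fun t => (t - w) * g t) r.+1 z
    = (z 0%N - w) * divdiff_rec g r.+1 z + divdiff_rec g r (fun l => z l.+1).
  by apply: IHr => l m lm; apply: z_inj; lia.
pose z1 l := z l.+1.
have IHu : divdiff_rec (fun t => (t - w) * g t) r.+1 z1
    = (z1 0%N - w) * divdiff_rec g r.+1 z1 + divdiff_rec g r (fun l => z1 l.+1).
  by apply: IHr => l m lm; apply: z_inj; lia.
have d1 : z1 r.+1 - z1 0%N != 0 by rewrite subr_eq0 eq_sym z_inj ?leqnn.
have d : z r.+2 - z 0%N != 0 by rewrite subr_eq0 eq_sym z_inj ?leqnn.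
(* Trading [z_1 - w] for [z_(r+2) - w] costs exactly the numerator of the
   divided difference of [g] over the upper nodes. *)
have IHu' : divdiff_rec (fun t => (t - w) * g t) r.+1 z1
    = (z r.+2 - w) * divdiff_rec g r.+1 z1 + divdiff_rec g r z1.
  have E : (z1 r.+1 - z1 0%N) * divdiff_rec g r.+1 z1
      = divdiff_rec g r (fun l => z1 l.+1) - divdiff_rec g r z1.
    by rewrite /= mulrC divfK.
  rewrite IHu -[divdiff_rec g r (fun l => z1 l.+1)](subrK (divdiff_rec g r z1)).
  by rewrite -E /z1; ring.
have unfold h : divdiff_rec h r.+2 z
    = (divdiff_rec h r.+1 z1 - divdiff_rec h r.+1 z) / (z r.+2 - z 0%N) by [].
rewrite !unfold IHu' IHl -/z1.
move: (divdiff_rec g r z1) (divdiff_rec g r.+1 z1) (divdiff_rec g r.+1 z).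
by move=> p q s; field.
Qed.

(** Removing one linear factor and one node at a time by the Leibniz rule ends
    with the constant [1] on [r - size ws + 1] nodes. *)
Lemma divdiff_prod (R : realType) (ws : seq R) r (z : nat -> R) :
  (size ws <= r)%N ->
  (forall l m, (l < m <= r)%N -> z l != z m) ->
  divdiff_rec (fun t => \prod_(w <- ws) (t - w)) r z = (size ws == r)%:R.
Proof.
elim: ws r z => [|w ws IHws] r z sz_ws z_inj.
  rewrite (eq_divdiff_rec (g := fun=> 1) (z' := z)) //; last first.
    by move=> l _; rewrite big_nil.
  have const1 r' z' : divdiff_rec (fun=> 1 : R) r'.+1 z' = 0.
    elim: r' z' => [|r' IH] z'; first by rewrite /= subrr mul0r.
    pose D z := divdiff_rec (fun=> 1 : R) r'.+1 z.
    rewrite -[LHS]/((D (fun l => z' l.+1) - D z') / _) /D.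
    by rewrite !IH subrr mul0r.
  by case: r {sz_ws z_inj} => [|r] //; rewrite const1.
case: r sz_ws z_inj => [|r] //= sz_ws z_inj.
have := divdiff_rec_mulXsub w (fun t => \prod_(w <- ws) (t - w)) z_inj.
rewrite !IHws ?leqW //; last by move=> l m lm; apply: z_inj; lia.
rewrite (ltn_eqF (n := r.+1)) // mulr0 add0r eqSS => <-.
by apply: (@eq_divdiff_rec _ _ _ r.+1) => // l _; rewrite big_cons.
Qed.

(** * Discrete derivatives at the design points *)

Lemma design_lt (R : realType) n (x : nat -> R)
    (hx : forall i : nat, (1 <= i < n)%N -> x i < x i.+1) i j :
  (1 <= i < j)%N -> (j <= n)%N -> x i < x j.
Proof.
elim: j => [|j IHj] ij jn; first by lia.
have [ej|nej] := eqVneq i j; first by rewrite ej; apply: hx; lia.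
by apply: (lt_trans (y := x j)); [apply: IHj | apply: hx]; lia.
Qed.

Lemma design_le (R : realType) n (x : nat -> R)
    (hx : forall i : nat, (1 <= i < n)%N -> x i < x i.+1) i j :
  (1 <= i <= j)%N -> (j <= n)%N -> x i <= x j.
Proof.
move=> ij jn; have [->//|nej] := eqVneq i j.
by apply/ltW/(design_lt hx); lia.
Qed.

Lemma design_neq (R : realType) n (x : nat -> R)
    (hx : forall i : nat, (1 <= i < n)%N -> x i < x i.+1) s r :
  (0 < s)%N -> (s + r <= n)%N ->
  forall l m, (l < m <= r)%N -> x (s + l)%N != x (s + m)%N.
Proof. by move=> s0 srn l m lm; rewrite lt_eqF // (design_lt hx); lia. Qed.

Lemma divdiff_iota (R : realType) (f : R -> R) (x : nat -> R) s r :
  divdiff f (rcons [seq x l | l <- index_iota s (s + r)] (x (s + r)%N))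
  = divdiff_rec f r (fun l => x (s + l)%N).
Proof.
have -> : rcons [seq x l | l <- index_iota s (s + r)] (x (s + r)%N)
    = [seq x l | l <- iota s r.+1].
  by rewrite -map_rcons /index_iota addKn -addn1 iotaD cats1.
rewrite /divdiff size_map size_iota [r.+1.-1]/=.
by apply: eq_divdiff_rec => // l lr; rewrite (nth_map 0%N) ?size_iota // nth_iota.
Qed.

(** The half-open intervals [(x_p, x_(p+1)]] are disjoint, so the choice made
    in the definition at [x_(i+1)] can only be [p = i]. *)
Lemma discrete_deriv_design (R : realType) n (x : nat -> R)
    (hx : forall i : nat, (1 <= i < n)%N -> x i < x i.+1) d (f : R -> R) i :
  (0 < i < n)%N ->
  discrete_deriv n x d f (x i.+1)
  = if (d <= i)%N then
      d`!%:R * divdiff f (rcons [seq x l | l <- index_iota (i - d).+1 i.+1]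
                            (x i.+1))
    else
      i`!%:R * divdiff f (rcons [seq x l | l <- index_iota 1 i.+1] (x i.+1)).
Proof.
move=> i_bd; rewrite /discrete_deriv leNgt (design_lt hx) //=; try by lia.
case: pickP => [p /and3P [p0 xp xpS] | none]; last first.
  have i_ord : (i < n.+1)%N by lia.
  have := none (Ordinal i_ord); rewrite /= lexx andbT hx //.
  by case/andP: i_bd => ->.
suff -> : nat_of_ord p = i by [].
have pn := ltn_ord p.
case: (ltngtP p i) => // pi.
- by move: xpS; rewrite leNgt (design_lt hx) //; lia.
- by move: xp; rewrite ltNge (design_le hx) //; lia.
Qed.

Lemma discrete_deriv_low (R : realType) n (x : nat -> R)
    (hx : forall i : nat, (1 <= i < n)%N -> x i < x i.+1) k (f : R -> R) i :
  (i <= k)%N -> (i < n)%N ->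
  discrete_deriv n x k.+1 f (x i.+1)
  = i`!%:R * divdiff_rec f i (fun l => x (1 + l)%N).
Proof.
case: i => [|i] ik i_n.
  by rewrite /discrete_deriv lexx /= mul1r.
rewrite -(divdiff_iota f x 1 i.+1) add1n.
by rewrite discrete_deriv_design // ltnNge ik.
Qed.

Lemma discrete_deriv_high (R : realType) n (x : nat -> R)
    (hx : forall i : nat, (1 <= i < n)%N -> x i < x i.+1) k (f : R -> R) m :
  (0 < m)%N -> (m + k.+1 <= n)%N ->
  discrete_deriv n x k.+1 f (x (m + k.+1)%N)
  = k.+1`!%:R * divdiff_rec f k.+1 (fun l => x (m + l)%N).
Proof.
move=> m0 mkn; rewrite addnS discrete_deriv_design //; last by lia.
have -> : (k < m + k)%N by lia.
have -> : (m + k - k.+1).+1 = m by lia.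
by rewrite -addnS divdiff_iota.
Qed.

(** The factor [x_i - x_(i-k-1)] is the last denominator of the divided
    difference. *)
Lemma discrete_deriv_high_weighted (R : realType) n (x : nat -> R)
    (hx : forall i : nat, (1 <= i < n)%N -> x i < x i.+1) k (f : R -> R) m :
  (0 < m)%N -> (m + k.+1 <= n)%N ->
  discrete_deriv n x k.+1 f (x (m + k.+1)%N)
    * ((x (m + k.+1)%N - x m) / k.+1%:R)
  = k`!%:R * (divdiff_rec f k (fun l => x (m.+1 + l)%N)
              - divdiff_rec f k (fun l => x (m + l)%N)).
Proof.
move=> m0 mkn; rewrite (discrete_deriv_high hx) //= addn0.
have -> : divdiff_rec f k (fun l => x (m + l.+1)%N)
    = divdiff_rec f k (fun l => x (m.+1 + l)%N).
  by apply: eq_divdiff_rec => // l _; rewrite addnS.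
have d : x (m + k.+1)%N - x m != 0.
  by rewrite subr_eq0 gt_eqF // (design_lt hx); lia.
have k0 : k.+1%:R != 0 :> R by rewrite pnatr_eq0.
rewrite factS natrM.
move: d k0; move: (x (m + k.+1)%N - x m) k.+1%:R => u v d k0.
by field; rewrite d k0.
Qed.

Lemma eq_discrete_deriv (R : realType) n (x : nat -> R)
    (hx : forall i : nat, (1 <= i < n)%N -> x i < x i.+1) k (f g : R -> R) :
  (forall i, (1 <= i <= n)%N -> f (x i) = g (x i)) ->
  forall i, (1 <= i <= n)%N ->
  discrete_deriv n x k.+1 f (x i) = discrete_deriv n x k.+1 g (x i).
Proof.
move=> fg i i_bd; have [ik|ki] := leqP i k.+1.
  case: i i_bd ik => [|i] i_bd ik; first by lia.
  rewrite !(discrete_deriv_low hx) //; congr (_ * _).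
  by apply: eq_divdiff_rec => // l li; apply: fg; lia.
have -> : i = (i - k.+1 + k.+1)%N by lia.
rewrite !(discrete_deriv_high hx); try by lia.
by congr (_ * _); apply: eq_divdiff_rec => // l li; apply: fg; lia.
Qed.

(** * The falling factorial basis at the design points *)

Lemma ffact_basis_design_eq0 (R : realType) n (x : nat -> R)
    (hx : forall i : nat, (1 <= i < n)%N -> x i < x i.+1) k i j :
  (1 <= i < j)%N -> (j <= n)%N -> ffact_basis k x j (x i) = 0.
Proof.
move=> ij jn; rewrite /ffact_basis; case: ifP => jk.
  rewrite (big_cat_nat _ (n := i)) ?(big_ltn (m := i)) /=; try by lia.
  by rewrite subrr mul0r !mulr0.
by rewrite ltNge (design_le hx) ?mulr0 //; lia.
Qed.

(** Left of the knot the indicator is [0], but there the product vanishes as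
    well at the [k] design points [x_(j-k), ..., x_(j-1)]. *)
Lemma ffact_basis_design_prod (R : realType) n (x : nat -> R)
    (hx : forall i : nat, (1 <= i < n)%N -> x i < x i.+1) k i j :
  (k.+1 < j)%N -> (j - k <= i <= n)%N ->
  ffact_basis k x j (x i) = k`!%:R^-1 * \prod_(j - k <= l < j) (x i - x l).
Proof.
move=> kj i_bd; rewrite /ffact_basis leqNgt kj /=.
have [ij|ji] := ltnP i j.
  rewrite (big_cat_nat _ (n := i)) ?(big_ltn (m := i)) /=; try by lia.
  by rewrite subrr mul0r !mulr0 mul0r.
by rewrite (design_lt hx) ?mulr1 //; lia.
Qed.

Lemma ffact_basis_diag_neq0 (R : realType) n (x : nat -> R)
    (hx : forall i : nat, (1 <= i < n)%N -> x i < x i.+1) k j :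
  (1 <= j <= n)%N -> ffact_basis k x j (x j) != 0.
Proof.
move=> j_bd.
have prod_neq0 s : (0 < s)%N -> \prod_(s <= l < j) (x j - x l) != 0.
  move=> s0; rewrite prodf_seq_neq0; apply/allP => l; rewrite mem_index_iota.
  by move=> lj; rewrite subr_eq0 gt_eqF // (design_lt hx); lia.
rewrite /ffact_basis; case: ifP => jk.
  by rewrite mulf_neq0 ?prod_neq0 // invr_eq0 pnatr_eq0 -lt0n fact_gt0.
rewrite (design_lt hx) ?mulr1; try by lia.
by rewrite mulf_neq0 ?prod_neq0 ?invr_eq0 ?pnatr_eq0 -?lt0n ?fact_gt0 //; lia.
Qed.

(** * Biorthogonality of weighted divided differences and basis *)

Lemma divdiff_ffact (R : realType) n (x : nat -> R)
    (hx : forall i : nat, (1 <= i < n)%N -> x i < x i.+1) (a : R) p q s r :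
  (0 < s)%N -> (s + r <= n)%N -> (q - p <= r)%N ->
  divdiff_rec (fun t => a * \prod_(p <= l < q) (t - x l)) r
    (fun l => x (s + l)%N)
  = a * (q - p == r)%N%:R.
Proof.
move=> s0 srn qpr; rewrite divdiff_recZ; congr (_ * _).
have sz : size [seq x l | l <- index_iota p q] = (q - p)%N.
  by rewrite size_map size_iota.
rewrite -{}sz in qpr *.
rewrite -(divdiff_prod qpr (design_neq hx s0 srn)).
by apply: eq_divdiff_rec => // l _; rewrite big_map.
Qed.

Lemma divdiff_basis_low (R : realType) n (x : nat -> R)
    (hx : forall i : nat, (1 <= i < n)%N -> x i < x i.+1) k i j :
  (i <= k)%N -> (i < n)%N -> (1 <= j <= n)%N ->
  i`!%:R * divdiff_rec (ffact_basis k x j) i (fun l => x (1 + l)%N)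
  = (j == i.+1)%:R.
Proof.
move=> ik i_n j_bd; have [ij|ji] := ltnP i.+1 j.
  rewrite (eq_divdiff_rec (g := fun=> 0) (z' := fun l => x (1 + l)%N)) //.
    by rewrite divdiff_rec0 mulr0 gtn_eqF.
  by move=> l li; apply: (ffact_basis_design_eq0 hx); lia.
rewrite (eq_divdiff_rec (z' := fun l => x (1 + l)%N)
  (g := fun t => (j.-1)`!%:R^-1 * \prod_(1 <= l < j) (t - x l))) //; last first.
  by move=> l _; rewrite /ffact_basis ifT //; lia.
rewrite (divdiff_ffact hx) //; last by lia.
have -> : (j - 1 == i)%N = (j == i.+1) by lia.
case: eqP => [->|_]; last by rewrite !mulr0.
by rewrite mulr1 mulfV // pnatr_eq0 -lt0n fact_gt0.
Qed.

Lemma divdiff_basis_high (R : realType) n (x : nat -> R)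
    (hx : forall i : nat, (1 <= i < n)%N -> x i < x i.+1) k m j :
  (0 < m)%N -> (m + k.+1 <= n)%N -> (1 <= j <= n)%N ->
  k`!%:R * (divdiff_rec (ffact_basis k x j) k (fun l => x (m.+1 + l)%N)
            - divdiff_rec (ffact_basis k x j) k (fun l => x (m + l)%N))
  = (j == m + k.+1)%:R.
Proof.
move=> m0 mkn j_bd.
have eq_dd g s : (forall l, (l <= k)%N ->
      ffact_basis k x j (x (s + l)%N) = g (x (s + l)%N)) ->
    divdiff_rec (ffact_basis k x j) k (fun l => x (s + l)%N)
    = divdiff_rec g k (fun l => x (s + l)%N).
  by move=> eqg; apply: eq_divdiff_rec.
have [jk|kj] := leqP j k.+1.
  pose g t := (j.-1)`!%:R^-1 * \prod_(1 <= l < j) (t - x l).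
  rewrite !(eq_dd g); try by move=> l _; rewrite /ffact_basis jk.
  by rewrite !(divdiff_ffact hx) ?subrr ?mulr0 ?ltn_eqF //; lia.
pose g t := k`!%:R^-1 * \prod_(j - k <= l < j) (t - x l).
have [jm|mj|jm] := ltngtP j (m + k.+1).
- rewrite !(eq_dd g); try by move=> l lk; apply: (ffact_basis_design_prod hx); lia.
  by rewrite !(divdiff_ffact hx) ?subrr ?mulr0 //; lia.
- rewrite !(eq_dd (fun=> 0)); try by move=> l lk; apply: (ffact_basis_design_eq0 hx); lia.
  by rewrite !divdiff_rec0 subrr mulr0.
- rewrite (eq_dd g); last by move=> l lk; apply: (ffact_basis_design_prod hx); lia.
  rewrite (eq_dd (fun=> 0)); last by move=> l lk; apply: (ffact_basis_design_eq0 hx); lia.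
  rewrite divdiff_rec0 subr0 (divdiff_ffact hx); try by lia.
  have -> : (j - (j - k) == k)%N by lia.
  by rewrite mulr1 mulfV // pnatr_eq0 -lt0n fact_gt0.
Qed.

Lemma sum_pick (R : realType) n (c : nat -> R) i :
  (1 <= i <= n)%N -> \sum_(1 <= j < n.+1) c j * (j == i)%:R = c i.
Proof.
move=> i_bd; rewrite (bigD1_seq i) ?iota_uniq ?mem_index_iota //= eqxx mulr1.
by rewrite big1 ?addr0 // => j /negbTE ->; rewrite mulr0.
Qed.

(** * Coefficients of a discrete spline *)

(** Expanding the divided difference over the basis leaves only the term
    [j = i]; knowing [f] at the design points is enough. *)
Lemma coef_low (R : realType) n (x : nat -> R)
    (hx : forall i : nat, (1 <= i < n)%N -> x i < x i.+1) k (f : R -> R)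
    (c : nat -> R) :
  (forall i, (1 <= i <= n)%N ->
     f (x i) = \sum_(1 <= j < n.+1) c j * ffact_basis k x j (x i)) ->
  forall i, (1 <= i <= k.+1)%N -> (i <= n)%N ->
  c i = discrete_deriv n x k.+1 f (x i).
Proof.
move=> fE i i_bd i_n.
pose s t := \sum_(1 <= j < n.+1) c j * ffact_basis k x j t.
rewrite (eq_discrete_deriv hx k (g := s) fE); last by lia.
case: i i_bd i_n => [|i] i_bd i_n; first by lia.
rewrite (discrete_deriv_low hx) //.
rewrite divdiff_rec_sum mulr_sumr -[LHS](sum_pick c (i_n : 1 <= i.+1 <= n)%N).
apply: eq_big_nat => j j_bd.
by rewrite mulrCA (divdiff_basis_low hx) //; lia.
Qed.

Lemma coef_high (R : realType) n (x : nat -> R)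
    (hx : forall i : nat, (1 <= i < n)%N -> x i < x i.+1) k (f : R -> R)
    (c : nat -> R) :
  (forall i, (1 <= i <= n)%N ->
     f (x i) = \sum_(1 <= j < n.+1) c j * ffact_basis k x j (x i)) ->
  forall i, (k.+2 <= i <= n)%N ->
  c i = discrete_deriv n x k.+1 f (x i)
        * ((x i - x (i - k.+1)%N) / k.+1%:R).
Proof.
move=> fE i i_bd.
pose s t := \sum_(1 <= j < n.+1) c j * ffact_basis k x j t.
rewrite (eq_discrete_deriv hx k (g := s) fE); last by lia.
have iE : i = (i - k.+1 + k.+1)%N by lia.
have m0 : (0 < i - k.+1)%N by lia.
move: (i - k.+1)%N m0 iE i_bd => m m0 -> i_bd.
rewrite (discrete_deriv_high_weighted hx); try by lia.
have i1n : (1 <= m + k.+1 <= n)%N by lia.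
rewrite !divdiff_rec_sum -sumrB mulr_sumr -[LHS](sum_pick c i1n).
apply: eq_big_nat => j j_bd.
by rewrite -mulrBr mulrCA (divdiff_basis_high hx) //; lia.
Qed.

Lemma triangular_solve (R : realType) n (T : nat -> nat -> R) (y : nat -> R) :
  (forall i, (1 <= i <= n)%N -> T i i != 0) ->
  (forall i j, (1 <= i < j)%N -> (j <= n)%N -> T i j = 0) ->
  exists c : nat -> R, forall i, (1 <= i <= n)%N ->
    \sum_(1 <= j < n.+1) c j * T i j = y i.
Proof.
elim: n => [|n IHn] diag upper; first by exists (fun=> 0) => i; lia.
case: IHn => [i i_bd|i j ij jn|c cP]; first by apply: diag; lia.
  by apply: upper; lia.
pose v := (y n.+1 - \sum_(1 <= j < n.+1) c j * T n.+1 j) / T n.+1 n.+1.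
exists (fun j => if (j == n.+1)%N then v else c j) => i i_bd.
rewrite big_nat_recr //= eqxx.
rewrite (eq_big_nat _ _ (F2 := fun j => c j * T i j)); last first.
  by move=> j /andP [_ jn]; rewrite ltn_eqF.
have [ni|ni] := eqVneq i n.+1.
  by rewrite ni /v divfK ?diag ?leqnn //; rewrite addrC subrK.
by rewrite upper ?mulr0 ?addr0 ?cP //; lia.
Qed.

Theorem theorem3 (R : realType) (a b : R) (n k : nat) (x y : nat -> R)
    (hn : (k.+1 <= n)%N)
    (hax : a <= x 1%N)
    (hx : forall i : nat, (1 <= i < n)%N -> x i < x i.+1)
    (hxb : x n <= b)
    (hb : x n.+1 = b) :
  (* the discrete derivatives at the design points depend only on y *)
  (forall g1 g2 : R -> R,
     (forall i : nat, (1 <= i <= n)%N -> g1 (x i) = y i) ->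
     (forall i : nat, (1 <= i <= n)%N -> g2 (x i) = y i) ->
     forall i : nat, (1 <= i <= n)%N ->
       discrete_deriv n x k.+1 g1 (x i) = discrete_deriv n x k.+1 g2 (x i)) /\
  exists f : R -> R,
    [/\ discrete_spline a b n k x f,
        forall i : nat, (1 <= i <= n)%N -> f (x i) = y i,
        {in `[a, b], forall t : R,
          f t = \sum_(1 <= i < k.+2)
                  discrete_deriv n x k.+1 f (x i) * ffact_basis k x i t
              + \sum_(k.+2 <= i < n.+1)
                  discrete_deriv n x k.+1 f (x i)
                  * ((x i - x (i - k.+1)%N) / k.+1%:R) * ffact_basis k x i t},
        (* uniqueness of the interpolant *)
        forall g : R -> R, discrete_spline a b n k x g ->
          (forall i : nat, (1 <= i <= n)%N -> g (x i) = y i) ->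
          {in `[a, b], g =1 f}
      & (* uniqueness of its coefficients *)
        forall c : nat -> R,
          {in `[a, b], forall t : R,
            f t = \sum_(1 <= j < n.+1) c j * ffact_basis k x j t} ->
          (forall i : nat, (1 <= i <= k.+1)%N ->
             c i = discrete_deriv n x k.+1 f (x i)) /\
          (forall i : nat, (k.+2 <= i <= n)%N ->
             c i = discrete_deriv n x k.+1 f (x i)
                   * ((x i - x (i - k.+1)%N) / k.+1%:R))].
Proof.
have indep (g1 g2 : R -> R) :
    (forall i : nat, (1 <= i <= n)%N -> g1 (x i) = y i) ->
    (forall i : nat, (1 <= i <= n)%N -> g2 (x i) = y i) ->
    forall i : nat, (1 <= i <= n)%N ->
    discrete_deriv n x k.+1 g1 (x i) = discrete_deriv n x k.+1 g2 (x i).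
  move=> g1y g2y; apply: (eq_discrete_deriv hx) => i i_bd.
  by rewrite g1y ?g2y.
split=> //.
have x_ab i : (1 <= i <= n)%N -> x i \in `[a, b].
  move=> i_bd; rewrite in_itv /= (le_trans hax) ?(le_trans _ hxb) //.
    by apply: (design_le hx); lia.
  by apply: (design_le hx); lia.
have [c cP] : exists c : nat -> R, forall i, (1 <= i <= n)%N ->
    \sum_(1 <= j < n.+1) c j * ffact_basis k x j (x i) = y i.
  apply: (triangular_solve (T := fun i j => ffact_basis k x j (x i))).
    by move=> i; apply: ffact_basis_diag_neq0.
  by move=> i j; apply: ffact_basis_design_eq0.
pose f t := \sum_(1 <= j < n.+1) c j * ffact_basis k x j t.
have coefP (g : R -> R) (c' : nat -> R) :
    {in `[a, b], forall t : R,
      g t = \sum_(1 <= j < n.+1) c' j * ffact_basis k x j t} ->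
    (forall i, (1 <= i <= k.+1)%N -> c' i = discrete_deriv n x k.+1 g (x i)) /\
    (forall i, (k.+2 <= i <= n)%N ->
       c' i = discrete_deriv n x k.+1 g (x i)
              * ((x i - x (i - k.+1)%N) / k.+1%:R)).
  move=> gE; have gE' i (i_bd : (1 <= i <= n)%N) := gE _ (x_ab i i_bd).
  split=> i i_bd; last exact: coef_high hx _ _ _ gE' _ i_bd.
  by apply: (coef_low hx gE' i_bd); lia.
have [f_low f_high] : _ /\ _ := coefP f c (fun t _ => erefl).
exists f; split.
- by exists c.
- exact: cP.
- move=> t _; rewrite /f (big_cat_nat _ (n := k.+2)) //=.
  congr (_ + _); apply: eq_big_nat => i i_bd; first by rewrite f_low.
  by rewrite f_high.
- move=> g [c' gE] gy t t_ab; rewrite gE // /f.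
  have [g_low g_high] := coefP g c' gE.
  apply: eq_big_nat => i i_bd; congr (_ * _).
  have eq_d := indep g f gy cP i i_bd.
  have [ik|ki] := leqP i k.+1.
    by rewrite g_low ?f_low ?eq_d //; lia.
  by rewrite g_high ?f_high ?eq_d //; lia.
- by move=> c'; apply: coefP.
Qed.
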